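(* There exists a real sequence $\lambda=(\lambda_{IJ})_{I,J\in\mathcal{D}}$ such that $\|P_\lambda\|_{2\to2}<\infty$ but $\|P_{|\lambda|}\|_{2\to2}=\infty$, where $|\lambda|=(|\lambda_{IJ}|)_{I,J\in\mathcal{D}}$. In other words, $P_\lambda$ is bounded, but not unconditionally bounded.
   Context: Functions are real-valued, and $\mathcal{D}$ is the standard dyadic grid in $\mathbb{R}$, i.e. the collection of intervals $[k2^{-i},(k+1)2^{-i})$, $i,k\in\mathbb{Z}$. Letters $I,J$ always denote elements of $\mathcal{D}$. For $I\in\mathcal{D}$ let $h_I=|I|^{-1/2}(1_{I_l}-1_{I_r})$, where $I_l,I_r$ are the left and right halves of $I$. For a real sequence $\lambda=(\lambda_{IJ})_{I,J\in\mathcal{D}}$ define the bilinear form $$P_\lambda(f,g)=\sum_{I,J}\lambda_{IJ}\Big\langle f,h_I\otimes\frac{1_J}{|J|}\Big\rangle\Big\langle g,\frac{1_I}{|I|}\otimes h_J\Big\rangle$$ for $f\in\mathcal{A}$, $g\in\mathcal{B}$, where $\mathcal{A}$ (resp. $\mathcal{B}$) is the set of $f=\sum_{I,J}f_{IJ}h_I\otimes h_J\in L^2(\mathbb{R}^2)$ with $\|f\|_2=1$ such that $f_{IJ}\neq0$ for only finitely many $I$ (resp. only finitely many $J$); the sum defining $P_\lambda(f,g)$ is then finite. Set $\|P_\lambda\|_{2\to2}=\sup_{f\in\mathcal{A},\,g\in\mathcal{B}}|P_\lambda(f,g)|\in[0,\infty]$. $P_\lambda$ is bounded if $\|P_\lambda\|_{2\to2}<\infty$,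 and unconditionally bounded if $\sup_\epsilon\|P_{\epsilon\lambda}\|_{2\to2}<\infty$, the supremum being over all sign sequences $\epsilon=(\epsilon_{IJ})$, $\epsilon_{IJ}=\pm1$, with $\epsilon\lambda=(\epsilon_{IJ}\lambda_{IJ})$. *)

(* Defs.v *)
From mathcomp Require Import all_boot all_order all_algebra finmap.
From mathcomp Require Import all_classical all_reals all_analysis.
Set Implicit Arguments.
Unset Strict Implicit.
Unset Printing Implicit Defensive.
Import Order.TTheory GRing.Theory Num.Theory.
Import numFieldNormedType.Exports.
Local Open Scope classical_set_scope.
Local Open Scope ring_scope.

(* The pair (i, k) stands for the dyadic interval [k 2^-i, (k+1) 2^-i[; this
   indexing is one-to-one (dyadic_itv_inj below). *)
Definition dyadic : Type := (int * int)%type.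

Section DyadicHaar.
Context {R : realType}.
Implicit Types I J : dyadic.

Definition dyadic_len I : R := 2 ^ (- I.1).

Definition dyadic_itv I : set R :=
  `[I.2%:~R * dyadic_len I, (I.2 + 1)%:~R * dyadic_len I[%classic.

Definition dyadic_left I : dyadic := (I.1 + 1, 2 * I.2).
Definition dyadic_right I : dyadic := (I.1 + 1, 2 * I.2 + 1).

Definition haar I (x : R) : R :=
  (Num.sqrt (dyadic_len I))^-1 *
  (\1_(dyadic_itv (dyadic_left I)) x - \1_(dyadic_itv (dyadic_right I)) x).

Definition average I (x : R) : R := \1_(dyadic_itv I) x / dyadic_len I.

Definition tensor (u v : R -> R) (z : R * R) : R := u z.1 * v z.2.

Definition plane_measure :
    {measure set (measurableTypeR R * measurableTypeR R) -> \bar R} :=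
  (@lebesgue_measure R \x @lebesgue_measure R)%E.

Definition inner (f g : R * R -> R) : R :=
  (\int[plane_measure]_z (f z * g z))%R.

Definition L2norm (f : R * R -> R) : \bar R :=
  Lnorm plane_measure 2%:E (EFin \o f).

Definition haar_partial_sum (c : dyadic -> dyadic -> R)
    (F : {fset dyadic * dyadic}) (z : R * R) : R :=
  \sum_(p <- F) c p.1 p.2 * tensor (haar p.1) (haar p.2) z.

(* f = sum_{I,J} c_IJ (h_I tensor h_J), with unconditional convergence in L^2. *)
Definition haar_expansion (c : dyadic -> dyadic -> R) (f : R * R -> R) : Prop :=
  forall e : R, 0 < e -> exists F0 : {fset dyadic * dyadic},
    forall F : {fset dyadic * dyadic}, (F0 `<=` F)%fset ->
      (L2norm (f \- haar_partial_sum c F)%R < e%:E)%E.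

Definition classA : set (R * R -> R) := [set f |
  [/\ f \in Lfun plane_measure 2%:E, L2norm f = 1%E &
      exists2 c : dyadic -> dyadic -> R, haar_expansion c f &
        finite_set [set I | exists J, c I J != 0]]].

Definition classB : set (R * R -> R) := [set f |
  [/\ f \in Lfun plane_measure 2%:E, L2norm f = 1%E &
      exists2 c : dyadic -> dyadic -> R, haar_expansion c f &
        finite_set [set J | exists I, c I J != 0]]].

(* The finitely supported sum is used only at f in classA, g in classB. There
   the first factor vanishes for all but finitely many I, and the second for
   all but finitely many J, so the default value 0 of an infinitely supported
   sum does not occur. *)
Definition P_form (lam : dyadic -> dyadic -> R) (f g : R * R -> R) : R :=
  \sum_(p \in [set: dyadic * dyadic])
    lam p.1 p.2 * inner f (tensor (haar p.1) (average p.2))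
                * inner g (tensor (average p.1) (haar p.2)).

Definition P_norm (lam : dyadic -> dyadic -> R) : \bar R :=
  ereal_sup [set `|P_form lam f g|%:E | f in classA & g in classB].

Definition P_bounded (lam : dyadic -> dyadic -> R) : Prop :=
  (P_norm lam < +oo)%E.

Definition sign_sequence (eps : dyadic -> dyadic -> R) : Prop :=
  forall I J, eps I J = 1 \/ eps I J = -1.

Definition P_unconditionally_bounded (lam : dyadic -> dyadic -> R) : Prop :=
  (ereal_sup [set P_norm (fun I J => (eps I J * lam I J)%R) |
              eps in [set eps | sign_sequence eps]] < +oo)%E.

Lemma dyadic_len_gt0 I : 0 < dyadic_len I.
Proof. by rewrite /dyadic_len exprz_gt0. Qed.

Lemma lebesgue_measure_dyadic_itv I :
  lebesgue_measure (dyadic_itv I) = (dyadic_len I)%:E.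
Proof.
have h := dyadic_len_gt0 I.
rewrite /dyadic_itv lebesgue_measure_itv /= lte_fin.
rewrite ltr_pM2r // ltr_int ltrDl ltr01 -EFinB -mulrBl -intrB.
by rewrite addrAC subrr add0r mul1r.
Qed.

Lemma dyadic_itv_inj : injective dyadic_itv.
Proof.
move=> I J IJ.
have E : dyadic_len I = dyadic_len J.
  by apply: EFin_inj; rewrite -!lebesgue_measure_dyadic_itv IJ.
have h := dyadic_len_gt0 J.
have sub K L : dyadic_itv K = dyadic_itv L ->
    L.2%:~R * dyadic_len L <= K.2%:~R * dyadic_len K :> R.
  move=> KL; have : dyadic_itv L (K.2%:~R * dyadic_len K).
    rewrite -KL /dyadic_itv /= in_itv /= lexx /= ltr_pM2r ?dyadic_len_gt0 //.
    by rewrite ltr_int ltrDl ltr01.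
  by rewrite /dyadic_itv /= in_itv /= => /andP[].
have := sub _ _ IJ; have := sub _ _ (esym IJ).
rewrite E !ler_pM2r // !ler_int => IJ2 JI2.
have e2 : I.2 = J.2 by apply/eqP; rewrite eq_le IJ2 JI2.
have e1 : I.1 = J.1.
  apply: oppr_inj; move: E; rewrite /dyadic_len => E.
  by apply: (@ieexprIz R 2); rewrite ?ltr0n ?pnatr_eq1.
by move: e1 e2; case: I {IJ E IJ2 JI2} => a b; case: J {h} => a' b' /= -> ->.
Qed.

End DyadicHaar.

(* Main.v *)
Require Import Defs.
From mathcomp Require Import all_boot all_order all_algebra finmap.
From mathcomp Require Import all_classical all_reals all_analysis.
From mathcomp Require Import measurable_realfun ring lra zify.
Require Import Defs.
Set Implicit Arguments.
Unset Strict Implicit.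
Unset Printing Implicit Defensive.
Import Order.TTheory GRing.Theory Num.Theory.
Import numFieldNormedType.Exports.
Local Open Scope classical_set_scope.
Local Open Scope ring_scope.

(** The form only sees each pair (I, J) through the average of the I-th Haar
    coefficient of f over J and the average of the J-th Haar coefficient of g
    over I, and the product of two such averages is an integral over the
    rectangle I x J.  Hence, for I of generation i and J of generation j inside
    the unit interval and
      lam_IJ = |I|^(1/2) |J|^(1/2) m_ij,
    the form is
      P_lam(f, g) = int int sum_(i, j) m_ij U_i(x, y) V_j(x, y) dx dy,
    where U_i(x, y) = |I|^(-1/2) f_I(y) for the interval I of generation i that
    contains x, f_I being the I-th Haar coefficient of f in the first variable,
    and symmetrically for V_j.  By the Bessel inequality the integral of
    sum_i U_i^2 is at most the square of the norm of f, so P_lam is bounded as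
    soon as m is bounded on l^2.

    Conversely, U_i may be taken constant on the unit square: f is a normalised
    sum, over a block of n generations i, of the functions |I|^(1/2) h_I in x,
    times one function that is constant on the unit interval in y; g is its
    mirror image.  This makes the form a fixed multiple of n^(-1) times the sum
    of the entries of the block.  So any matrix m will do that is bounded on
    l^2 while n^(-1) times the sum of |m_ij| over an n x n diagonal block can be
    arbitrarily large: m is the direct sum over k of the normalised Hadamard
    matrices of size 2^k, placed on the generations 2^k <= i < 2^(k+1).  Each
    block is orthogonal (walsh_bound, scale_matrix_bound), but its entries all
    have absolute value 2^(-k/2), and 2^k * 2^(-k/2) is unbounded
    (P_form_profile).

    The upper bound is made finite-dimensional: only the integrals of f and g
    over dyadic rectangles enter, these are additive under halving either side,
    and an infinitely supported sum has value 0.  Fixing one generation n finer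
    than all those that occur, the double integral becomes a sum over the 4^n
    cells of generation n (sum_cells), and the Bessel inequality a telescoping
    identity (haar_bessel).  The only analysis left is the Cauchy-Schwarz
    inequality on each cell (sum_sqr_box_integral).  The lower bound needs the
    orthonormality of the Haar functions (dot_haar) and Fubini's theorem for
    tensor products (inner_tensor). *)

(** * A bounded matrix whose absolute values are unbounded *)

Section Hadamard.
Variable R : rcfType.
Implicit Types (u v : nat -> R).

Lemma sum_even_odd (m n : nat) (F : nat -> R) :
  \sum_(m.*2 <= i < n.*2) F i = \sum_(m <= i < n) (F i.*2 + F i.*2.+1).
Proof.
elim: n => [|n IHn]; first by rewrite !big_geq.
have [mn|nm] := leqP m n; last by rewrite !big_geq // -?doubleS ?leq_double.
rewrite doubleS big_nat_recr ?(leq_trans _ (leqnSn _)) ?leq_double //=.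
by rewrite big_nat_recr ?leq_double //= big_nat_recr //= IHn addrA.
Qed.

(** The normalised Hadamard matrix of size 2^k: the sign counts, modulo 2, the
    common ones among the k lowest binary digits of i and j.  Higher digits are
    ignored, so the same function serves the indices 2^k <= i < 2^(k+1). *)
Fixpoint walsh (k i j : nat) : R :=
  if k is k'.+1 then
    (-1) ^+ (odd i && odd j) / Num.sqrt 2 * walsh k' i./2 j./2
  else 1.

Lemma sqr_sqrt2 : Num.sqrt 2 ^+ 2 = 2 :> R.
Proof. by rewrite sqr_sqrtr. Qed.

Lemma norm_walsh k i j : `|walsh k i j| = (Num.sqrt 2)^-1 ^+ k.
Proof.
elim: k i j => [|k IHk] i j /=; first by rewrite normr1.
rewrite !normrM IHk normrX normrN1 expr1n mul1r exprS; congr (_ * _).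
by rewrite ger0_norm // invr_ge0 sqrtr_ge0.
Qed.

(** The step from k to k + 1 splits the indices by parity.  The block form
    [[H, H], [H, -H]] / sqrt 2 of the matrix turns u into the pair
    (P, M) = ((u' + u'') / sqrt 2, (u' - u'') / sqrt 2), a rotation.  Half the
    sum of squares on the right, rather than the product of norms, is what
    makes the bounds of the two halves, and later of all the blocks, add up. *)
Lemma walsh_bound k u v :
  `|\sum_(2 ^ k <= i < 2 ^ k.+1) \sum_(2 ^ k <= j < 2 ^ k.+1)
      walsh k i j * (u i * v j)| <=
  (\sum_(2 ^ k <= i < 2 ^ k.+1) u i ^+ 2 +
   \sum_(2 ^ k <= j < 2 ^ k.+1) v j ^+ 2) / 2.
Proof.
elim: k u v => [|k IHk] u v.
  rewrite !big_nat1 mul1r normrM.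
  have := sqr_ge0 (`|u 1| - `|v 1|).
  by rewrite -(real_normK (num_real (u 1))) -(real_normK (num_real (v 1))); nra.
have s2 : Num.sqrt 2 != 0 :> R by rewrite sqrtr_eq0 -ltNge.
have E n : (2 ^ n.+1 = (2 ^ n).*2)%N by rewrite expnS mul2n.
rewrite E in IHk; rewrite !E; set p := (2 ^ k)%N; set q := p.*2 in IHk *.
pose P i := (u i.*2 + u i.*2.+1) / Num.sqrt 2.
pose M i := (u i.*2 - u i.*2.+1) / Num.sqrt 2.
have -> : \sum_(p.*2 <= i < q.*2) \sum_(p.*2 <= j < q.*2)
      walsh k.+1 i j * (u i * v j) =
   \sum_(p <= i < q) \sum_(p <= j < q) walsh k i j * (P i * v j.*2) +
   \sum_(p <= i < q) \sum_(p <= j < q) walsh k i j * (M i * v j.*2.+1).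
  rewrite sum_even_odd -big_split; apply: eq_bigr => i _ /=.
  rewrite !sum_even_odd -!big_split; apply: eq_bigr => j _ /=.
  rewrite !odd_double /= !uphalf_double !doubleK /P /M.
  by field.
have := IHk P (fun j => v j.*2); have := IHk M (fun j => v j.*2.+1).
have -> : \sum_(p.*2 <= i < q.*2) u i ^+ 2 =
   \sum_(p <= i < q) P i ^+ 2 + \sum_(p <= i < q) M i ^+ 2.
  rewrite sum_even_odd -big_split; apply: eq_bigr => i _ /=.
  by rewrite /P /M !expr_div_n sqr_sqrt2; field.
rewrite sum_even_odd big_split /=.
move=> b1 b2; apply: le_trans (ler_normD _ _) _.
by move: b1 b2; lra.
Qed.

(** The direct sum of the matrices [walsh k]; the index 0 is left out of the
    bounds below because trunc_log puts it in the block of 1. *)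
Definition scale_matrix (i j : nat) : R :=
  if trunc_log 2 i == trunc_log 2 j then walsh (trunc_log 2 i) i j else 0.

Lemma scale_matrix_bound K u v :
  `|\sum_(1 <= i < 2 ^ K) \sum_(1 <= j < 2 ^ K)
      scale_matrix i j * (u i * v j)| <=
  (\sum_(1 <= i < 2 ^ K) u i ^+ 2 + \sum_(1 <= j < 2 ^ K) v j ^+ 2) / 2.
Proof.
elim: K => [|K IHK]; first by rewrite !big_geq // normr0 addr0 mul0r.
have g0 n : (0 < 2 ^ n)%N by rewrite expn_gt0.
have le2 : (2 ^ K <= 2 ^ K.+1)%N by rewrite leq_exp2l.
have bl k i : (2 ^ k <= i < 2 ^ k.+1)%N -> trunc_log 2 i = k.
  by move=> h; apply: trunc_log_eq.
have sm i : (1 <= i < 2 ^ K)%N -> (trunc_log 2 i < K)%N.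
  by move=> /andP[i0 iK]; rewrite -(ltn_exp2l _ _ (isT : 1 < 2)%N)
       (leq_ltn_trans (trunc_logP _ _)).
have -> : \sum_(1 <= i < 2 ^ K.+1) \sum_(1 <= j < 2 ^ K.+1)
      scale_matrix i j * (u i * v j) =
   \sum_(1 <= i < 2 ^ K) \sum_(1 <= j < 2 ^ K) scale_matrix i j * (u i * v j) +
   \sum_(2 ^ K <= i < 2 ^ K.+1) \sum_(2 ^ K <= j < 2 ^ K.+1)
      walsh K i j * (u i * v j).
  rewrite (big_cat_nat (g0 K) le2) /=; congr (_ + _).
    apply: eq_big_nat => i /sm hi; rewrite (big_cat_nat (g0 K) le2) /=.
    rewrite [X in _ + X]big_nat_cond [X in _ + X]big1 ?addr0 //.
    move=> j; rewrite andbT => /bl hj.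
    by rewrite /scale_matrix hj ltn_eqF // mul0r.
  apply: eq_big_nat => i /bl hi; rewrite (big_cat_nat (g0 K) le2) /=.
  rewrite [X in X + _]big_nat_cond [X in X + _]big1 ?add0r.
    apply: eq_big_nat => j /bl hj; rewrite /scale_matrix hi hj eqxx //.
  move=> j; rewrite andbT => /sm hj.
  by rewrite /scale_matrix hi gtn_eqF // mul0r.
apply: le_trans (ler_normD _ _) _.
rewrite ![\sum_(1 <= _ < 2 ^ K.+1) _](big_cat_nat (g0 K) le2) /=.
by move: IHK (walsh_bound K u v); lra.
Qed.

Lemma norm_scale_matrix k i j : (2 ^ k <= i < 2 ^ k.+1)%N ->
  (2 ^ k <= j < 2 ^ k.+1)%N -> `|scale_matrix i j| = (Num.sqrt 2)^-1 ^+ k.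
Proof.
move=> hi hj; rewrite /scale_matrix.
by rewrite (trunc_log_eq _ hi) // (trunc_log_eq _ hj) // eqxx norm_walsh.
Qed.

End Hadamard.

(** * The form on functions constant on small cells *)

Section Discrete.
Variable R : rcfType.

(** [S i k] stands for the integral of a function over the k-th interval of
    generation i. *)
Definition dyadic_additive (S : nat -> nat -> R) :=
  forall i k, S i k = S i.+1 k.*2 + S i.+1 k.*2.+1.

(** The parallelogram identity turns the squared differences of generation i
    into an increment of [2 ^+ i * \sum_k S i k ^+ 2], so the sum telescopes. *)
Lemma haar_bessel (S : nat -> nat -> R) n : dyadic_additive S ->
  \sum_(0 <= i < n) 2 ^+ i *
    \sum_(0 <= k < 2 ^ i) (S i.+1 k.*2 - S i.+1 k.*2.+1) ^+ 2 <=
  2 ^+ n * \sum_(0 <= c < 2 ^ n) S n c ^+ 2.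
Proof.
move=> add; pose W i := 2 ^+ i * \sum_(0 <= c < 2 ^ i) S i c ^+ 2.
have W0 : 0 <= W 0%N by rewrite mulr_ge0 // sumr_ge0 // => ? _; exact: sqr_ge0.
suff -> : \sum_(0 <= i < n) 2 ^+ i *
    \sum_(0 <= k < 2 ^ i) (S i.+1 k.*2 - S i.+1 k.*2.+1) ^+ 2 =
    \sum_(0 <= i < n) (W i.+1 - W i).
  by rewrite telescope_sumr // lerBlDr lerDl.
apply: eq_bigr => i _; rewrite /W exprS expnS mul2n -[0%N]double0 sum_even_odd.
rewrite double0 [2 * _]mulrC -mulrA -mulrBr; congr (_ * _).
rewrite mulr_sumr -sumrB; apply: eq_bigr => k _.
by rewrite (add i k); ring.
Qed.

(** The interval of generation i that contains the cell c of generation n is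
    the one with index c %/ 2 ^ (n - i). *)
Lemma sum_ancestors (F : nat -> nat -> R) i n : (i <= n)%N ->
  \sum_(0 <= c < 2 ^ n) F c (c %/ 2 ^ (n - i))%N =
  \sum_(0 <= k < 2 ^ i)
    \sum_(k * 2 ^ (n - i) <= c < k.+1 * 2 ^ (n - i)) F c k.
Proof.
move=> le_in; rewrite -{1}(subnKC le_in) expnD big_nat_mul.
apply: eq_bigr => k _; apply: eq_big_nat => c /andP[kc ck].
congr F; apply/eqP; rewrite eqn_leq leq_divRL ?expn_gt0 // kc andbT.
by rewrite -ltnS ltn_divLR ?expn_gt0.
Qed.

Lemma sum_descendants (S : nat -> nat -> R) i n k : dyadic_additive S ->
  (i <= n)%N -> S i k = \sum_(k * 2 ^ (n - i) <= c < k.+1 * 2 ^ (n - i)) S n c.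
Proof.
move=> add /subnKC <-; rewrite addKn; elim: (n - i)%N k => {n} [|p IHp] k.
  by rewrite expn0 addn0 !muln1 big_nat1.
rewrite IHp expnS mul2n -!doubleMr sum_even_odd addnS.
by apply: eq_bigr => c _; apply: add.
Qed.

(** F and G stand for the integrals of f and g over the dyadic rectangles, the
    first two indices giving the first side.  Up to normalisation, D and E are
    then the two kinds of coefficients that enter the form. *)
Variables F G : nat -> nat -> nat -> nat -> R.
Hypothesis F1 : forall j l, dyadic_additive (fun i k => F i k j l).
Hypothesis F2 : forall i k, dyadic_additive (F i k).
Hypothesis G1 : forall j l, dyadic_additive (fun i k => G i k j l).
Hypothesis G2 : forall i k, dyadic_additive (G i k).

Let D i k j l := F i.+1 k.*2 j l - F i.+1 k.*2.+1 j l.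
Let E i k j l := G i k j.+1 l.*2 - G i k j.+1 l.*2.+1.

(** D is still additive in its second interval and E in its first, so each
    factor is a sum over cells in the variable where it is not oscillating. *)
Lemma sum_cells n i j : (i <= n)%N -> (j <= n)%N ->
  \sum_(0 <= k < 2 ^ i) \sum_(0 <= l < 2 ^ j) D i k j l * E i k j l =
  \sum_(0 <= c < 2 ^ n) \sum_(0 <= d < 2 ^ n)
    D i (c %/ 2 ^ (n - i))%N n d * E n c j (d %/ 2 ^ (n - j))%N.
Proof.
move=> le_in le_jn.
rewrite (sum_ancestors (fun c k => \sum_(0 <= d < 2 ^ n)
  D i k n d * E n c j (d %/ 2 ^ (n - j))%N) le_in).
apply: eq_bigr => k _; rewrite exchange_big /=.
rewrite (sum_ancestors (fun d l =>
  \sum_(k * 2 ^ (n - i) <= c < k.+1 * 2 ^ (n - i))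
    D i k n d * E n c j l) le_jn).
apply: eq_bigr => l _.
have -> : D i k j l =
    \sum_(l * 2 ^ (n - j) <= d < l.+1 * 2 ^ (n - j)) D i k n d.
  apply: (sum_descendants (S := D i k)) => // a b.
  by rewrite /D (F2 i.+1 k.*2) (F2 i.+1 k.*2.+1); ring.
have -> : E i k j l =
    \sum_(k * 2 ^ (n - i) <= c < k.+1 * 2 ^ (n - i)) E n c j l.
  apply: (sum_descendants (S := fun a b => E a b j l)) => // a b.
  by rewrite /E (G1 j.+1 l.*2 a b) (G1 j.+1 l.*2.+1 a b); ring.
by rewrite mulr_suml; apply: eq_bigr => d _; rewrite mulr_sumr.
Qed.

(** Summing over the cells below an interval of generation i counts it
    2^(n-i) times, which lowers the factor 4^i to the 2^i of the Bessel
    inequality. *)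
Lemma sum_sqr_haar (S : nat -> nat -> R) n : dyadic_additive S ->
  \sum_(0 <= c < 2 ^ n) \sum_(1 <= i < n)
    (2 ^+ i * (S i.+1 (c %/ 2 ^ (n - i)).*2 -
               S i.+1 (c %/ 2 ^ (n - i)).*2.+1)) ^+ 2
  <= 4 ^+ n * \sum_(0 <= c < 2 ^ n) S n c ^+ 2.
Proof.
move=> add.
have -> : 4 ^+ n = 2 ^+ n * 2 ^+ n :> R by rewrite -exprMn -natrM.
rewrite -mulrA.
apply: le_trans (ler_wpM2l _ (haar_bessel n add)); last exact: exprn_ge0.
rewrite exchange_big /= mulr_sumr.
pose T i := 2 ^+ n * (2 ^+ i *
  \sum_(0 <= k < 2 ^ i) (S i.+1 k.*2 - S i.+1 k.*2.+1) ^+ 2).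
have T0 i : 0 <= T i.
  by rewrite !mulr_ge0 // sumr_ge0 // => ? _; exact: sqr_ge0.
(* The Bessel sum starts at generation 0, the left-hand side at 1. *)
have [->|n0] := posnP n; first by rewrite !big_geq.
rewrite [leRHS](big_cat_nat (n := 1)) //= big_nat1 -[leLHS]add0r lerD ?T0 //.
rewrite ler_sum_nat // => i /andP[_ /ltnW le_in].
rewrite (sum_ancestors (fun _ k =>
  (2 ^+ i * (S i.+1 k.*2 - S i.+1 k.*2.+1)) ^+ 2) le_in) /T !mulr_sumr.
rewrite ler_sum // => k _; rewrite sumr_const_nat -mulnBl subSnn mul1n.
rewrite -[X in X <= _]mulr_natr natrX -[in X in _ <= X](subnK le_in) exprD.
by rewrite le_eqVlt; apply/orP; left; apply/eqP; ring.
Qed.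

(** On each pair of cells (c, d) the form is the matrix [scale_matrix] between
    the vectors U c d and V c d; the pointwise bounds are then integrated. *)
Lemma discrete_form_bound K n : n = (2 ^ K)%N ->
  `|\sum_(1 <= i < n) \sum_(1 <= j < n) scale_matrix R i j *
      (2 ^+ i * 2 ^+ j *
       \sum_(0 <= k < 2 ^ i) \sum_(0 <= l < 2 ^ j) D i k j l * E i k j l)| <=
  4 ^+ n * (\sum_(0 <= c < 2 ^ n) \sum_(0 <= d < 2 ^ n) F n c n d ^+ 2 +
            \sum_(0 <= c < 2 ^ n) \sum_(0 <= d < 2 ^ n) G n c n d ^+ 2) / 2.
Proof.
move=> En.
pose U c d i := 2 ^+ i * D i (c %/ 2 ^ (n - i))%N n d.
pose V c d j := 2 ^+ j * E n c j (d %/ 2 ^ (n - j))%N.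
have -> : \sum_(1 <= i < n) \sum_(1 <= j < n) scale_matrix R i j *
      (2 ^+ i * 2 ^+ j *
       \sum_(0 <= k < 2 ^ i) \sum_(0 <= l < 2 ^ j) D i k j l * E i k j l) =
   \sum_(0 <= c < 2 ^ n) \sum_(0 <= d < 2 ^ n)
     \sum_(1 <= i < n) \sum_(1 <= j < n)
       scale_matrix R i j * (U c d i * V c d j).
  under [RHS]eq_bigr do rewrite exchange_big.
  rewrite [RHS]exchange_big; apply: eq_big_nat => i /andP[_ /ltnW le_in].
  under [RHS]eq_bigr do rewrite exchange_big.
  rewrite [RHS]exchange_big; apply: eq_big_nat => j /andP[_ /ltnW le_jn].
  rewrite (sum_cells le_in le_jn) !mulr_sumr; apply: eq_bigr => c _.
  rewrite !mulr_sumr; apply: eq_bigr => d _; rewrite /U /V; ring.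
apply: le_trans (ler_norm_sum _ _ _) _.
apply: (@le_trans _ _ (\sum_(0 <= c < 2 ^ n) \sum_(0 <= d < 2 ^ n)
   (\sum_(1 <= i < n) U c d i ^+ 2 + \sum_(1 <= j < n) V c d j ^+ 2) / 2)).
  rewrite ler_sum // => c _; apply: le_trans (ler_norm_sum _ _ _) _.
  rewrite ler_sum // => d _; rewrite [in leLHS]En [in leRHS]En.
  exact: scale_matrix_bound.
under eq_bigr do rewrite -mulr_suml big_split /=.
rewrite -mulr_suml big_split /= ler_pM2r ?invr_gt0 // mulrDr lerD //.
  rewrite exchange_big [X in _ <= _ * X]exchange_big mulr_sumr.
  by apply: ler_sum => d _; exact: (sum_sqr_haar n (F1 n d)).
rewrite mulr_sumr.
by apply: ler_sum => c _; exact: (sum_sqr_haar n (G2 n c)).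
Qed.

End Discrete.

(** * Square integrable functions *)

Section SquareIntegrable.
Context d (T : measurableType d) (R : realType) (m : {measure set T -> \bar R}).
Implicit Types u v : T -> R.

Let one_le_two : (1 <= 2%:E :> \bar R)%E.
Proof. by rewrite lee_fin ler1n. Qed.

Lemma Lfun2_measurable u : u \in Lfun m 2%:E -> measurable_fun setT u.
Proof. by move=> /sub_Lfun_mfun; rewrite inE. Qed.

Lemma Lfun2_of_sqr u :
  measurable_fun setT u ->
  m.-integrable setT (EFin \o (fun x => u x ^+ 2)) ->
  u \in Lfun m 2%:E /\
  Lnorm m 2%:E (EFin \o u) = ((\int[m]_x (u x ^+ 2)%:E) `^ 2^-1)%E.
Proof.
move=> meas_u iu.
have E : Lnorm m 2%:E (EFin \o u) = ((\int[m]_x (u x ^+ 2)%:E) `^ 2^-1)%E.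
  rewrite unlock; congr (_ `^ _)%E; apply: eq_integral => x _ /=.
  by rewrite powR_mulrn // real_normK ?num_real.
split => //.
rewrite inE; apply/andP; split; rewrite inE //=.
rewrite /finite_norm E poweR_lty //.
case/integrableP: iu => _; apply: le_lt_trans.
rewrite le_eqVlt; apply/orP; left; apply/eqP; apply: eq_integral => x _ /=.
by rewrite ger0_norm ?sqr_ge0.
Qed.

Lemma Lfun2D u v : u \in Lfun m 2%:E -> v \in Lfun m 2%:E ->
  (fun x => u x + v x) \in Lfun m 2%:E.
Proof.
by move=> hu hv; have [_ /(_ u v hu hv)] := Lfun_addr_closed m one_le_two.
Qed.

Lemma Lfun2Z (c : R) u : u \in Lfun m 2%:E ->
  (fun x => c * u x) \in Lfun m 2%:E.
Proof.
move=> hu; rewrite (_ : (fun x => c * u x) = c \o* u).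
  exact: Lfun_scale (ler1n _ 2) hu.
by apply/funext => x /=; rewrite mulrC.
Qed.

Lemma Lfun2_sum (A : Type) (s : seq A) (F : A -> T -> R) :
  (forall a, F a \in Lfun m 2%:E) ->
  (fun x => \sum_(a <- s) F a x) \in Lfun m 2%:E.
Proof.
move=> hF; elim: s => [|a s IHs].
  under eq_fun do rewrite big_nil.
  by have [] := Lfun_addr_closed m one_le_two.
by under eq_fun do rewrite big_cons; exact: Lfun2D.
Qed.

Lemma integrableM u v : u \in Lfun m 2%:E -> v \in Lfun m 2%:E ->
  m.-integrable setT (EFin \o (fun x => u x * v x)).
Proof. by move=> hu hv; apply/Lfun1_integrable; exact: Lfun2_mul_Lfun1. Qed.

End SquareIntegrable.

(** * Integrals over dyadic rectangles *)

Section Dyadic.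
Variable R : realType.
Implicit Types I J : dyadic.

Lemma measurable_dyadic_itv I : measurable (@dyadic_itv R I).
Proof. exact: measurable_itv. Qed.

Lemma dyadic_len_half I : dyadic_len (dyadic_left I) = dyadic_len I / 2 :> R.
Proof.
by rewrite /dyadic_len /= opprD expfzDr ?pnatr_eq0 // exprN1.
Qed.

Lemma dyadic_itv_halves I : @dyadic_itv R I =
  dyadic_itv (dyadic_left I) `|` dyadic_itv (dyadic_right I).
Proof.
have h := @dyadic_len_gt0 R (dyadic_left I).
have e : dyadic_len I = 2 * dyadic_len (dyadic_left I) :> R.
  by rewrite dyadic_len_half mulrC divfK.
have e' : dyadic_len (dyadic_right I) = dyadic_len (dyadic_left I) :> R by [].
rewrite /dyadic_itv e e' /=.
rewrite !intrD !intrM.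
apply/seteqP; split => x /=; rewrite !in_itv /=; last first.
  by case=> /andP[h1 h2]; apply/andP; split; nra.
move=> /andP[h1 h2].
have [h3|h3] := ltP x ((2%:~R * I.2%:~R + 1%:~R) * dyadic_len (dyadic_left I)).
  by left; apply/andP; split; nra.
by right; apply/andP; split; nra.
Qed.

Lemma dyadic_itv_halves_disjoint I :
  [disjoint @dyadic_itv R (dyadic_left I) & dyadic_itv (dyadic_right I)].
Proof.
apply/disj_setPS => x; rewrite /dyadic_itv /= !in_itv /=.
move=> -[/andP[_ h1] /andP[h2 _]].
by have := lt_le_trans h1 h2; rewrite ltxx.
Qed.

Definition box I J : set (measurableTypeR R * measurableTypeR R) :=
  dyadic_itv I `*` dyadic_itv J.

Lemma measurable_box I J : measurable (box I J).
Proof. by apply: measurableX; exact: measurable_dyadic_itv. Qed.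

Lemma plane_measure_box I J :
  plane_measure (box I J) = (dyadic_len I * dyadic_len J)%:E :> \bar R.
Proof.
rewrite /plane_measure [LHS]product_measure1E; try exact: measurable_dyadic_itv.
by rewrite EFinM; congr (_ * _)%E; exact: lebesgue_measure_dyadic_itv.
Qed.

Definition locally_integrable (f : R * R -> R) :=
  forall I J, plane_measure.-integrable (box I J) (EFin \o f).

Definition box_integral (f : R * R -> R) I J : R :=
  (\int[plane_measure]_(z in box I J) f z)%R.

Lemma box_halves1 I J :
  box I J = box (dyadic_left I) J `|` box (dyadic_right I) J.
Proof.
rewrite /box (dyadic_itv_halves I).
by apply/seteqP; split=> -[x y] /= => [[[]]|[[]|[]]]; tauto.
Qed.

Lemma box_halves2 I J :
  box I J = box I (dyadic_left J) `|` box I (dyadic_right J).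
Proof.
rewrite /box (dyadic_itv_halves J).
by apply/seteqP; split=> -[x y] /= => [[? []]|[[]|[]]]; tauto.
Qed.

Lemma box_integral_halves1 f I J : locally_integrable f ->
  box_integral f I J =
  box_integral f (dyadic_left I) J + box_integral f (dyadic_right I) J.
Proof.
move=> intf; rewrite /box_integral -Rintegral_setU; try exact: measurable_box.
- by rewrite -box_halves1.
- by rewrite -box_halves1; exact: intf.
- apply/disj_setPS => -[x y] /= -[[h1 _] [h2 _]].
  by have /disj_setPS/(_ x) := dyadic_itv_halves_disjoint I; apply.
Qed.

Lemma box_integral_halves2 f I J : locally_integrable f ->
  box_integral f I J =
  box_integral f I (dyadic_left J) + box_integral f I (dyadic_right J).
Proof.
move=> intf; rewrite /box_integral -Rintegral_setU; try exact: measurable_box.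
- by rewrite -box_halves2.
- by rewrite -box_halves2; exact: intf.
- apply/disj_setPS => -[x y] /= -[[_ h1] [_ h2]].
  by have /disj_setPS/(_ y) := dyadic_itv_halves_disjoint J; apply.
Qed.

Lemma integrable_cst_box I J (c : R) :
  (@plane_measure R).-integrable (box I J) (EFin \o cst c).
Proof.
apply: measurable_bounded_integrable; first exact: measurable_box.
- by rewrite plane_measure_box ltry.
- exact: measurable_cst.
- exists (`|c|); split; first exact: num_real.
  by move=> x cx y _ /=; exact: ltW.
Qed.

Lemma Lfun2_sqr_locally_integrable f : f \in Lfun (@plane_measure R) 2%:E ->
  locally_integrable (fun z => f z ^+ 2).
Proof.
move=> /Lfun2_integrable_sqr intf I J.
by apply: integrableS intf => //; exact: measurable_box.
Qed.

Lemma Lfun2_locally_integrable f : f \in Lfun (@plane_measure R) 2%:E ->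
  locally_integrable f.
Proof.
move=> Lf I J; have mB := measurable_box I J.
apply: (@le_integrable _ _ _ _ _ _ _ (EFin \o (fun z => f z ^+ 2 + 1))) => //.
- by apply/measurable_EFinP; apply: measurable_funS (Lfun2_measurable Lf).
- move=> z _ /=; rewrite lee_fin.
  rewrite [leRHS]ger0_norm ?addr_ge0 ?sqr_ge0 // -real_normK ?num_real //.
  by have := sqr_ge0 (`|f z| - 1); have := normr_ge0 (f z); nra.
- apply: (integrableD mB (Lfun2_sqr_locally_integrable Lf I J)
             (integrable_cst_box I J 1)).
Qed.

(** Cauchy-Schwarz, from the nonnegative integral of the square of f minus its
    mean q / a over the rectangle. *)
Lemma sqr_box_integral_le f I J : f \in Lfun (@plane_measure R) 2%:E ->
  box_integral f I J ^+ 2 <=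
  dyadic_len I * dyadic_len J * box_integral (fun z => f z ^+ 2) I J.
Proof.
move=> Lf; have mB := measurable_box I J.
have i1 := Lfun2_locally_integrable Lf I J.
have i2 := Lfun2_sqr_locally_integrable Lf I J.
set a := dyadic_len I * dyadic_len J.
have a0 : 0 < a by rewrite mulr_gt0 ?dyadic_len_gt0.
set q := box_integral f I J; set s := box_integral _ I J.
have : 0 <= (\int[plane_measure]_(z in box I J)
    (f z ^+ 2 + (- 2 * (q / a) * f z + (q / a) ^+ 2)))%R.
  apply: Rintegral_ge0 => z _.
  suff -> : f z ^+ 2 + (- 2 * (q / a) * f z + (q / a) ^+ 2) =
    (f z - q / a) ^+ 2 by exact: sqr_ge0.
  by ring.
have i3 : plane_measure.-integrable (box I J)
   (EFin \o (fun z => - 2 * (q / a) * f z)).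
  exact: (integrableZl mB (- 2 * (q / a)) i1).
rewrite RintegralD //; last first.
  exact: (integrableD mB i3 (integrable_cst_box I J ((q / a) ^+ 2))).
rewrite RintegralD //; last exact: integrable_cst_box.
rewrite RintegralZl // Rintegral_cst // plane_measure_box.
rewrite -/(box_integral f I J) -/(box_integral _ I J) -/q -/s -/a /=.
have -> : - 2 * (q / a) * q + (q / a) ^+ 2 * a = - (q ^+ 2 / a).
  by field; rewrite gt_eqF.
rewrite subr_ge0 ler_pdivrMr //.
by rewrite mulrC.
Qed.

Lemma inner_haar_average f I J : locally_integrable f ->
  inner f (tensor (haar I) (average J)) =
  (Num.sqrt (dyadic_len I))^-1 / dyadic_len J *
  (box_integral f (dyadic_left I) J - box_integral f (dyadic_right I) J).
Proof.
move=> intf; have mB := measurable_box.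
rewrite /inner; pose g : measurableTypeR R * measurableTypeR R -> R := f.
transitivity ((\int[@plane_measure R]_z
   ((Num.sqrt (dyadic_len I))^-1 / dyadic_len J *
    ((g \_ (box (dyadic_left I) J)) z - (g \_ (box (dyadic_right I) J)) z)))%R).
  apply: eq_Rintegral => -[x y] _.
  rewrite /tensor /haar /average !patchE /g !indicE /= /box !in_setX /=.
  by case: (x \in _); case: (x \in _); case: (y \in _) => /=;
    rewrite -?[point]/(0 : R); ring.
have r K : plane_measure.-integrable setT (EFin \o (g \_ (box K J))).
  have := intf K J => /(integrable_mkcond _ (mB K J)).
  by rewrite -restrict_EFin.
rewrite RintegralZl //; last exact: (integrableB measurableT (r _) (r _)).
by rewrite RintegralB // -!Rintegral_mkcond.
Qed.

Lemma inner_average_haar f I J : locally_integrable f ->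
  inner f (tensor (average I) (haar J)) =
  (Num.sqrt (dyadic_len J))^-1 / dyadic_len I *
  (box_integral f I (dyadic_left J) - box_integral f I (dyadic_right J)).
Proof.
move=> intf; have mB := measurable_box.
rewrite /inner; pose g : measurableTypeR R * measurableTypeR R -> R := f.
transitivity ((\int[@plane_measure R]_z
   ((Num.sqrt (dyadic_len J))^-1 / dyadic_len I *
    ((g \_ (box I (dyadic_left J))) z - (g \_ (box I (dyadic_right J))) z)))%R).
  apply: eq_Rintegral => -[x y] _.
  rewrite /tensor /haar /average !patchE /g !indicE /= /box !in_setX /=.
  by case: (x \in _); case: (y \in _); case: (y \in _) => /=;
    rewrite -?[point]/(0 : R); ring.
have r K : plane_measure.-integrable setT (EFin \o (g \_ (box I K))).
  have := intf I K => /(integrable_mkcond _ (mB I K)).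
  by rewrite -restrict_EFin.
rewrite RintegralZl //; last exact: (integrableB measurableT (r _) (r _)).
by rewrite RintegralB // -!Rintegral_mkcond.
Qed.

Definition dyadic_nat (i k : nat) : dyadic := (Posz i, Posz k).

Lemma dyadic_left_nat i k : dyadic_left (dyadic_nat i k) = dyadic_nat i.+1 k.*2.
Proof. by rewrite /dyadic_left /dyadic_nat /=; congr pair; lia. Qed.

Lemma dyadic_right_nat i k :
  dyadic_right (dyadic_nat i k) = dyadic_nat i.+1 k.*2.+1.
Proof. by rewrite /dyadic_right /dyadic_nat /=; congr pair; lia. Qed.

Lemma dyadic_len_nat i k : dyadic_len (dyadic_nat i k) = 2 ^- i :> R.
Proof. by rewrite /dyadic_len /= exprnN. Qed.

Lemma box_integral_additive1 f j l : locally_integrable f ->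
  dyadic_additive (fun i k => box_integral f (dyadic_nat i k) (dyadic_nat j l)).
Proof.
move=> intf i k.
by rewrite box_integral_halves1 // dyadic_left_nat dyadic_right_nat.
Qed.

Lemma box_integral_additive2 f i k : locally_integrable f ->
  dyadic_additive (fun j l => box_integral f (dyadic_nat i k) (dyadic_nat j l)).
Proof.
move=> intf j l.
by rewrite box_integral_halves2 // dyadic_left_nat dyadic_right_nat.
Qed.

Lemma L2norm_sqr f : f \in Lfun (@plane_measure R) 2%:E -> L2norm f = 1%E ->
  (\int[plane_measure]_z (f z ^+ 2))%R = 1.
Proof.
move=> Lf N1; rewrite /Rintegral.
suff -> : (\int[plane_measure]_z (f z ^+ 2)%:E = 1)%E by [].
transitivity ((L2norm f) `^ 2)%E; last by rewrite N1 /= powR1.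
rewrite /L2norm powR_Lnorm ?pnatr_eq0 //; apply: eq_integral => z _ /=.
by rewrite powR_mulrn // real_normK ?num_real.
Qed.

(** Bessel for the normalised indicators of the 4^n cells.  The integrals of
    f ^+ 2 over the cells add up to the one over the unit square because they
    are additive too. *)
Lemma sum_sqr_box_integral f n : f \in Lfun (@plane_measure R) 2%:E ->
  L2norm f = 1%E ->
  4 ^+ n * \sum_(0 <= c < 2 ^ n) \sum_(0 <= d < 2 ^ n)
    box_integral f (dyadic_nat n c) (dyadic_nat n d) ^+ 2 <= 1.
Proof.
move=> Lf N1; have i2 := Lfun2_sqr_locally_integrable Lf.
pose s c d :=
  box_integral (fun z => f z ^+ 2) (dyadic_nat n c) (dyadic_nat n d).
apply: (@le_trans _ _ (\sum_(0 <= c < 2 ^ n) \sum_(0 <= d < 2 ^ n) s c d)).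
  rewrite mulr_sumr ler_sum // => c _; rewrite mulr_sumr ler_sum // => d _.
  rewrite -ler_pdivlMl ?exprn_gt0 //.
  apply: le_trans (sqr_box_integral_le _ _ Lf) _.
  by rewrite !dyadic_len_nat -invfM -exprMn -natrM.
have E c : \sum_(0 <= d < 2 ^ n) s c d =
    box_integral (fun z => f z ^+ 2) (dyadic_nat n c) (dyadic_nat 0 0).
  have := sum_descendants 0 (box_integral_additive2 n c i2) (leq0n n).
  by rewrite mul0n mul1n subn0 => ->.
under eq_bigr do rewrite E.
have := sum_descendants 0 (box_integral_additive1 0 0 i2) (leq0n n).
rewrite mul0n mul1n subn0 => <-.
rewrite -(L2norm_sqr Lf N1) /box_integral Rintegral_mkcond.
have mB := measurable_box (dyadic_nat 0 0) (dyadic_nat 0 0).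
apply: le_Rintegral => //.
- have := i2 (dyadic_nat 0 0) (dyadic_nat 0 0) => /(integrable_mkcond _ mB).
  by rewrite -restrict_EFin.
- exact: Lfun2_integrable_sqr.
- by move=> z _; rewrite patchE; case: ifP => // _; exact: sqr_ge0.
Qed.

End Dyadic.

(** * The coefficients and the upper bound *)

Section Upper.
Variable R : realType.
Implicit Types I J : dyadic.

(** The dyadic intervals contained in the unit interval, the unit interval
    itself excluded: generation 0 has no place in the blocks of the matrix. *)
Definition in_tree I : bool :=
  if I is (Posz i, Posz k) then (0 < i)%N && (k < 2 ^ i)%N else false.

Definition tree_range m n : seq dyadic :=
  [seq dyadic_nat i k | i <- index_iota m n, k <- index_iota 0 (2 ^ i)].

Lemma mem_tree_range m n i k : (dyadic_nat i k \in tree_range m n) =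
  (m <= i < n)%N && (k < 2 ^ i)%N.
Proof.
apply/allpairsPdep/idP => /= [[i' [k' [hi hk [-> ->]]]]|/andP[hi hk]].
  by move: hi hk; rewrite !mem_index_iota => -> /=.
by exists i, k; rewrite !mem_index_iota hi hk.
Qed.

Lemma uniq_tree_range m n : uniq (tree_range m n).
Proof.
apply: allpairs_uniq_dep => [|i _|]; try exact: iota_uniq.
by move=> [i k] [j l] _ _ /= [-> ->].
Qed.

Lemma in_treeE I n : in_tree I -> (`|I.1| < n)%N -> I \in tree_range 1 n.
Proof.
case: I => -[i|i] [k|k] //= /andP[i0 ki] hin.
by rewrite mem_tree_range i0 hin.
Qed.

Lemma fsum_tree (F : dyadic * dyadic -> R) m n :
  (forall p, F p != 0 ->
    (p.1 \in tree_range m n) && (p.2 \in tree_range m n)) ->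
  \sum_(p \in [set: dyadic * dyadic]) F p =
  \sum_(m <= i < n) \sum_(m <= j < n)
    \sum_(0 <= k < 2 ^ i) \sum_(0 <= l < 2 ^ j)
      F (dyadic_nat i k, dyadic_nat j l).
Proof.
move=> supp; rewrite fsbig_supp.
rewrite (fsbig_fwiden [seq (a, b) | a <- tree_range m n, b <- tree_range m n]).
- rewrite big_allpairs /tree_range big_allpairs_dep.
  apply: eq_bigr => i _.
  under eq_bigr do rewrite big_allpairs_dep.
  by rewrite exchange_big.
- move=> -[I J] [_ /= /eqP/supp /= /andP[hI hJ]].
  by apply/allpairsP; exists (I, J).
- by apply: allpairs_uniq; [exact: uniq_tree_range..|move=> [? ?] [? ?]].
- by move=> p [_ /not_andP[]//=]; rewrite notK.
Qed.

Definition hadamard_lam I J : R :=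
  if in_tree I && in_tree J then
    Num.sqrt (dyadic_len I) * Num.sqrt (dyadic_len J) *
    scale_matrix R `|I.1|%N `|J.1|%N
  else 0.

Lemma sqrt_dyadic_len_neq0 I : Num.sqrt (dyadic_len I) != 0 :> R.
Proof. by rewrite sqrtr_eq0 -ltNge dyadic_len_gt0. Qed.

(** When the sum defining the form has infinite support it is 0.  Otherwise
    some power 2^K bounds all the generations that occur, and the cancellation
    is used on the full square of generations 1 <= i, j < 2^K: the sum must be
    enlarged by zero terms to this square, for no bound holds on arbitrary
    subsets. *)
Lemma norm_P_form_hadamard_lam (f g : R * R -> R) :
  f \in Lfun (@plane_measure R) 2%:E -> L2norm f = 1%E ->
  g \in Lfun (@plane_measure R) 2%:E -> L2norm g = 1%E ->
  `|P_form hadamard_lam f g| <= 1.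
Proof.
move=> Lf f1 Lg g1; rewrite /P_form; set F := (X in \sum_(p \in _) X p).
set S := ([set: dyadic * dyadic] `&` F @^-1` [set~ 0]).
have [finS|infS] := pselect (finite_set S); last first.
  by rewrite fsbig_dflt // normr0.
have F0 p : F p != 0 -> in_tree p.1 && in_tree p.2.
  by apply: contra_neqT => h; rewrite /F /hadamard_lam (negPf h) !mul0r.
(* X is the finite support; n < 2 ^ n bounds every generation in it. *)
have [K HK] : exists K, forall p, F p != 0 ->
    (`|p.1.1| < 2 ^ K)%N && (`|p.2.1| < 2 ^ K)%N.
  pose X : seq (dyadic * dyadic) := fset_set S.
  pose size (p : dyadic * dyadic) := (`|p.1.1| + `|p.2.1|)%N.
  exists (\max_(p <- X) size p)%N => p Fp.
  have pX : p \in X.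
    rewrite -[_ \in _]/(p \in fset_set _) in_fset_set // inE.
    by split=> //; exact/eqP.
  have : (size p < 2 ^ \max_(p <- X) size p)%N.
    have h := @leq_bigmax_seq _ X xpredT size p pX isT.
    exact: leq_ltn_trans h (ltn_expl _ (isT : 1 < 2)%N).
  by move=> h; rewrite !(leq_ltn_trans _ h) /size ?leq_addl ?leq_addr.
rewrite (@fsum_tree _ 1 (2 ^ K)) => [|p Fp]; last first.
  have /andP[h1 h2] := F0 _ Fp; have /andP[h3 h4] := HK _ Fp.
  by rewrite !in_treeE.
have If := Lfun2_locally_integrable Lf; have Ig := Lfun2_locally_integrable Lg.
have := discrete_form_bound (fun j l => box_integral_additive1 j l If)
  (fun i k => box_integral_additive2 i k If)
  (fun j l => box_integral_additive1 j l Ig)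
  (fun i k => box_integral_additive2 i k Ig) (erefl (2 ^ K)%N).
move=> bound; apply: (le_trans (le_trans _ bound)); last first.
  have := sum_sqr_box_integral (2 ^ K) Lf f1.
  have := sum_sqr_box_integral (2 ^ K) Lg g1.
  by rewrite mulrDr; lra.
rewrite le_eqVlt; apply/orP; left; apply/eqP; congr `|_|.
apply: eq_big_nat => i /andP[i0 iK]; apply: eq_big_nat => j /andP[j0 jK].
rewrite !mulr_sumr; apply: eq_big_nat => k /andP[_ ki].
rewrite !mulr_sumr; apply: eq_big_nat => l /andP[_ lj].
rewrite /F /hadamard_lam /= i0 ki j0 lj /=.
rewrite inner_haar_average // inner_average_haar //.
rewrite !dyadic_left_nat !dyadic_right_nat.
have := sqrt_dyadic_len_neq0 (dyadic_nat i k).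
have := sqrt_dyadic_len_neq0 (dyadic_nat j l).
rewrite !dyadic_len_nat => s1 s2.
have := @expf_neq0 R 2 i; have := @expf_neq0 R 2 j.
rewrite pnatr_eq0 => /(_ isT) e1 /(_ isT) e2.
by field; apply/and4P; split.
Qed.

Lemma P_norm_hadamard_lam_le1 : (P_norm hadamard_lam <= 1)%E.
Proof.
apply: ge_ereal_sup => _ /= [f [Lf f1 _] [g [Lg g1 _] <-]].
by rewrite lee_fin norm_P_form_hadamard_lam.
Qed.

End Upper.

(** * Orthonormality of the Haar functions *)

Section Line.
Variable R : realType.
Implicit Types I J : dyadic.
Let mu := @lebesgue_measure R.
Implicit Types u v p q : measurableTypeR R -> R.

Lemma integrable_indic_dyadic I :
  mu.-integrable setT (EFin \o \1_(@dyadic_itv R I)).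
Proof. exact: integrable_indic_itv. Qed.

Lemma Lfun2_indic I :
  (\1_(@dyadic_itv R I) : measurableTypeR R -> R) \in Lfun mu 2%:E.
Proof.
apply: (proj1 (Lfun2_of_sqr _ _)).
- by apply: measurable_indic; exact: measurable_dyadic_itv.
- have -> : (fun x => \1_(dyadic_itv I) x ^+ 2) =
      \1_(@dyadic_itv R I) :> (R -> R).
    apply/funext => x; rewrite indicE.
    by case: (x \in _); rewrite ?expr1n ?expr0n.
  exact: integrable_indic_dyadic.
Qed.

Lemma Lfun2_haar I : (haar I : measurableTypeR R -> R) \in Lfun mu 2%:E.
Proof.
rewrite (_ : haar I = fun x => (Num.sqrt (dyadic_len I))^-1 *
    (\1_(dyadic_itv (dyadic_left I)) x +
     -1 * \1_(dyadic_itv (dyadic_right I)) x)).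
  by apply: Lfun2Z; apply: Lfun2D; [|apply: Lfun2Z]; exact: Lfun2_indic.
by apply/funext => x; rewrite mulN1r.
Qed.

Lemma Lfun2_average I : (average I : measurableTypeR R -> R) \in Lfun mu 2%:E.
Proof.
rewrite (_ : average I = fun x => (dyadic_len I)^-1 * \1_(dyadic_itv I) x).
  by apply: Lfun2Z; exact: Lfun2_indic.
by apply/funext => x; rewrite /average mulrC.
Qed.

Definition dot u v : R := (\int[mu]_x (u x * v x))%R.

Lemma dotC u v : dot u v = dot v u.
Proof. by apply: eq_Rintegral => x _; rewrite mulrC. Qed.

Lemma dot_sum (s : seq dyadic) (c : dyadic -> R)
    (F : dyadic -> measurableTypeR R -> R) v :
  (forall I, F I \in Lfun mu 2%:E) -> v \in Lfun mu 2%:E ->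
  dot (fun x => \sum_(I <- s) c I * F I x) v =
  \sum_(I <- s) c I * dot (F I) v.
Proof.
move=> hF hv; elim: s => [|I s IHs].
  rewrite big_nil /dot; under eq_Rintegral do rewrite big_nil mul0r.
  by rewrite Rintegral_cst ?mul0r.
rewrite big_cons -IHs /dot -RintegralZl //; last exact: integrableM.
rewrite -RintegralD //.
- by apply: eq_Rintegral => x _; rewrite big_cons mulrDl mulrA.
- have := integrableM (Lfun2Z (c I) (hF I)) hv.
  by under eq_fun do rewrite -mulrA.
- by apply: integrableM => //; apply: Lfun2_sum => J; exact: Lfun2Z.
Qed.

Lemma Rintegral_indic_dyadic I :
  (\int[mu]_x (\1_(@dyadic_itv R I) x))%R = dyadic_len I.
Proof.
rewrite /Rintegral integral_indic //; last exact: measurable_dyadic_itv.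
by rewrite setIT; have /(congr1 fine) := @lebesgue_measure_dyadic_itv R I.
Qed.

Lemma haar_itv I x : (@haar R I x != 0) -> dyadic_itv I x.
Proof.
rewrite /haar !indicE (dyadic_itv_halves R I) => h.
have [h1|h1] := boolP (x \in dyadic_itv (dyadic_left I)).
  by left; exact/set_mem.
have [h2|h2] := boolP (x \in dyadic_itv (dyadic_right I)).
  by right; exact/set_mem.
by move: h; rewrite (negPf h1) (negPf h2) subrr mulr0 eqxx.
Qed.

Lemma Rintegral_haar I : (\int[mu]_x (haar I x))%R = 0 :> R.
Proof.
have h := integrable_indic_dyadic.
rewrite /haar RintegralZl //; last exact: (integrableB measurableT (h _) (h _)).
by rewrite RintegralB // !Rintegral_indic_dyadic subrr mulr0.
Qed.

(** Since |I| = m |J| with m an integer, the endpoints of I are integer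
    multiples of |J|, hence none lies in the interior of J. *)
Lemma dyadic_itv_nested I J : I.1 <= J.1 ->
  @dyadic_itv R J `<=` dyadic_itv I \/ @dyadic_itv R J `&` dyadic_itv I = set0.
Proof.
move=> le_IJ.
have [[x [xJ xI]]|no] :=
  pselect (exists x, @dyadic_itv R J x /\ dyadic_itv I x); last first.
  by right; apply/seteqP; split=> // x [xJ xI]; apply: no; exists x.
left; have J0 := @dyadic_len_gt0 R J.
have [m len] : exists m : int, dyadic_len I = m%:~R * dyadic_len J :> R.
  exists (2 ^+ `|J.1 - I.1|%N); rewrite rmorphXn /= exprnP.
  rewrite gez0_abs ?subr_ge0 // /dyadic_len -expfzDr ?pnatr_eq0 //.
  by congr (_ ^ _); lia.
move: xJ xI; rewrite /dyadic_itv /= !in_itv /= len !mulrA -!intrM.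
move=> /andP[x1 x2] /andP[x3 x4].
have : I.2 * m < J.2 + 1.
  by rewrite -(@ltr_int R) -(ltr_pM2r J0); exact: le_lt_trans x3 x2.
have : J.2 < (I.2 + 1) * m.
  by rewrite -(@ltr_int R) -(ltr_pM2r J0); exact: le_lt_trans x1 x4.
rewrite ltzD1 -lezD1 => r1 r2 y /=; rewrite !in_itv /= => /andP[y1 y2].
apply/andP; split.
  by apply: le_trans y1; rewrite ler_pM2r // ler_int.
by apply: lt_le_trans y2 _; rewrite ler_pM2r // ler_int.
Qed.

Lemma haar_cst I J : I.1 < J.1 ->
  exists c : R, forall x, dyadic_itv J x -> haar I x = c.
Proof.
move=> lt_IJ.
have ind (K : dyadic) : K.1 <= J.1 ->
    exists c : R, forall x : R, dyadic_itv J x -> \1_(dyadic_itv K) x = c.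
  move=> /dyadic_itv_nested[sub|disj].
    by exists 1 => x Jx; rewrite indicE mem_set //; exact: sub.
  exists 0 => x Jx; rewrite indicE memNset // => Kx.
  by have : (dyadic_itv J `&` dyadic_itv K) x by []; rewrite disj.
have [|a ha] := ind (dyadic_left I); first by rewrite /= lezD1.
have [|b hb] := ind (dyadic_right I); first by rewrite /= lezD1.
exists ((Num.sqrt (dyadic_len I))^-1 * (a - b)) => x Jx.
by rewrite /haar ha // hb.
Qed.

Lemma dot_haar_lt I J : I.1 < J.1 -> dot (haar I) (haar J) = 0.
Proof.
move=> /haar_cst[c hc].
have iJ : mu.-integrable setT (EFin \o haar J).
  have h := integrable_indic_dyadic.
  exact: (integrableZl measurableT _ (integrableB measurableT (h _) (h _))).
transitivity (\int[mu]_x (c * haar J x))%R.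
  apply: eq_Rintegral => x _.
  have [->|/haar_itv/hc -> //] := eqVneq (haar J x) 0.
  by rewrite !mulr0.
by rewrite RintegralZl // Rintegral_haar mulr0.
Qed.

Lemma dot_haar I J : dot (haar I) (haar J) = (I == J)%:R.
Proof.
have [lt_IJ|lt_JI|eq_IJ] := ltgtP I.1 J.1.
- by rewrite dot_haar_lt //; case: eqP => // E; rewrite E ltxx in lt_IJ.
- by rewrite dotC dot_haar_lt //; case: eqP => // E; rewrite E ltxx in lt_JI.
have [<-|neq_IJ] := eqVneq I J.
  have l0 := @dyadic_len_gt0 R I.
  transitivity (\int[mu]_x ((dyadic_len I)^-1 * \1_(dyadic_itv I) x))%R.
    apply: eq_Rintegral => x _.
    have dis : (x \in @dyadic_itv R (dyadic_left I)) &&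
        (x \in dyadic_itv (dyadic_right I)) = false.
      apply/negbTE/negP => /andP[/set_mem h1 /set_mem h2].
      by have /disj_setPS/(_ x) := dyadic_itv_halves_disjoint R I; apply.
    rewrite /haar mulrACA -invfM -expr2 sqr_sqrtr ?ltW // !indicE.
    rewrite (dyadic_itv_halves R I) in_setU.
    by move: dis; case: (x \in _); case: (x \in _) => //= _; ring.
  rewrite RintegralZl //; last exact: integrable_indic_dyadic.
  by rewrite Rintegral_indic_dyadic mulVf ?gt_eqF.
transitivity (\int[mu]_x (0 : R))%R; last by rewrite Rintegral_cst // mul0r.
apply: eq_Rintegral => x _; apply/eqP/negPn/negP; rewrite mulf_eq0 negb_or.
move=> /andP[/haar_itv Ix /haar_itv Jx]; move/eqP: neq_IJ; apply.
apply: (@dyadic_itv_inj R); apply/seteqP.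
have [|sIJ|dis] := @dyadic_itv_nested J I; first by rewrite eq_IJ.
  have [|//|dis] := @dyadic_itv_nested I J; first by rewrite eq_IJ.
  by have : (dyadic_itv J `&` dyadic_itv I) x by []; rewrite dis.
by have : (dyadic_itv I `&` dyadic_itv J) x by []; rewrite dis.
Qed.

End Line.

(** * Tensor products *)

Section Tensor.
Variable R : realType.
Implicit Types I J : dyadic.
Let mu := @lebesgue_measure R.
Implicit Types u v p q : measurableTypeR R -> R.

Lemma integral_tensor p q :
  mu.-integrable setT (EFin \o p) -> mu.-integrable setT (EFin \o q) ->
  (@plane_measure R).-integrable setT (EFin \o tensor p q) /\
  (\int[@plane_measure R]_z tensor p q z)%R =
  (\int[mu]_x p x)%R * (\int[mu]_y q y)%R.
Proof.
move=> ip iq.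
have /measurable_EFinP mp := measurable_int _ ip.
have /measurable_EFinP mq := measurable_int _ iq.
have mpq : measurable_fun setT
    (EFin \o tensor p q : measurableTypeR R * measurableTypeR R -> \bar R).
  apply/measurable_EFinP; apply: measurable_funM.
    exact: measurableT_comp mp measurable_fst.
  exact: measurableT_comp mq measurable_snd.
have ipq : (@plane_measure R).-integrable setT (EFin \o tensor p q).
  apply/(integrable12ltyP _ _ mpq).
  have -> : (\int[mu]_x \int[mu]_y `|(EFin \o tensor p q) (x, y)| =
     \int[mu]_x (`|(p x)%:E| * \int[mu]_y `|(q y)%:E|))%E.
    apply: eq_integral => x _; rewrite -ge0_integralZl //.
    - by apply: eq_integral => y _; rewrite /= /tensor normrM EFinM.
    - by apply/measurable_EFinP; exact: measurableT_comp.
  rewrite ge0_integralZr //; last 2 first.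
  - by apply/measurable_EFinP; exact: measurableT_comp.
  - exact: integral_ge0.
  case/integrableP: ip => _ ip; case/integrableP: iq => _ iq.
  by rewrite lte_mul_pinfty // ?ge0_fin_numE // integral_ge0.
split => //.
rewrite /Rintegral -(integral12_prod_meas1 ipq).
have -> : (\int[mu]_x \int[mu]_y (EFin \o tensor p q) (x, y) =
     \int[mu]_x ((\int[mu]_y (q y)%:E) * (p x)%:E))%E.
  by apply: eq_integral => x _; rewrite muleC -integralZl.
rewrite -[in LHS](@fineK _ (\int[mu]_y (q y)%:E)%E); last first.
  exact: integrable_fin_num.
by rewrite integralZl // fineM ?integrable_fin_num // mulrC.
Qed.

Lemma inner_tensor u v u' v' :
  u \in Lfun mu 2%:E -> v \in Lfun mu 2%:E ->
  u' \in Lfun mu 2%:E -> v' \in Lfun mu 2%:E ->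
  inner (tensor u v) (tensor u' v') = dot u u' * dot v v'.
Proof.
move=> hu hv hu' hv'.
have [_ <-] := integral_tensor (integrableM hu hu') (integrableM hv hv').
by apply: eq_Rintegral => -[x y] _; rewrite /tensor /= mulrACA.
Qed.

Lemma tensor_unit u v :
  u \in Lfun mu 2%:E -> v \in Lfun mu 2%:E -> dot u u = 1 -> dot v v = 1 ->
  tensor u v \in Lfun (@plane_measure R) 2%:E /\ L2norm (tensor u v) = 1%E.
Proof.
move=> hu hv u1 v1.
have E : (fun z => tensor u v z ^+ 2) =
    tensor (fun x => u x * u x) (fun y => v y * v y) :> (R * R -> R).
  by apply/funext => -[x y]; rewrite /tensor /= -!expr2 exprMn.
have [i1 i2] := integral_tensor (integrableM hu hu) (integrableM hv hv).
have mt : measurable_fun setT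
    (tensor u v : measurableTypeR R * measurableTypeR R -> R).
  apply: measurable_funM.
    by apply: measurableT_comp measurable_fst; exact: Lfun2_measurable hu.
  by apply: measurableT_comp measurable_snd; exact: Lfun2_measurable hv.
have := Lfun2_of_sqr (m := @plane_measure R) mt.
rewrite E => /(_ i1) [-> N]; split=> //.
rewrite /L2norm N.
have -> : (\int[@plane_measure R]_z (tensor u v z ^+ 2)%:E =
  \int[@plane_measure R]_z
    (tensor (fun x => u x * u x) (fun y => v y * v y) z)%:E)%E.
  by apply: eq_integral => z _; rewrite -E.
rewrite -[(\int[_]_z _)%E]fineK; last exact: integrable_fin_num.
rewrite -/(Rintegral _ _ _) i2 -/(dot u u) -/(dot v v) u1 v1 mulr1.
by rewrite poweR_EFin powR1.
Qed.

End Tensor.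

(** * The lower bound *)

Section Lower.
Variable R : realType.
Implicit Types I J : dyadic.
Let mu := @lebesgue_measure R.
Let r : R := Num.sqrt 2.

Lemma finite_haar_expansion (C : dyadic -> dyadic -> R)
    (X : seq (dyadic * dyadic)) :
  uniq X -> (forall a b, (a, b) \notin X -> C a b = 0) ->
  haar_expansion C (fun z =>
    \sum_(p <- X) C p.1 p.2 * tensor (haar p.1) (haar p.2) z).
Proof.
move=> uX C0 e e0; exists [fset p in X]%fset => F subF.
rewrite /L2norm (_ : EFin \o _ = cst 0%E) ?Lnorm0 ?lte_fin //.
apply/funext => z /=; congr EFin; apply/eqP; rewrite subr_eq0; apply/eqP.
rewrite /haar_partial_sum -(big_fset_incl _ subF) /=; last first.
  by move=> [a b] _; rewrite !inE /= => /C0 ->; rewrite mul0r.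
apply: perm_big; apply: uniq_perm => [//||p]; first exact: fset_uniq.
by rewrite in_fset.
Qed.

(** The interval [0, 2[.  Its Haar function is constant on [0, 1[, so it does
    the work of the indicator of the unit interval while being a single term
    of the Haar basis: the test functions are finite Haar sums. *)
Definition double_unit : dyadic := (Negz 0, Posz 0).

Lemma haar_double_unit (x : R) : 0 <= x < 1 -> haar double_unit x = r^-1.
Proof.
move=> /andP[x0 x1]; rewrite /haar !indicE.
have -> : dyadic_left double_unit = dyadic_nat 0 0 by [].
have -> : dyadic_right double_unit = dyadic_nat 0 1 by [].
rewrite mem_set; last first.
  rewrite /dyadic_itv dyadic_len_nat expr0 invr1 !mulr1 /= in_itv /=.
  by apply/andP; split; lra.
rewrite memNset /= ?subr0 ?mulr1 //.
rewrite /dyadic_itv dyadic_len_nat expr0 invr1 !mulr1 /= in_itv /=.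
by move=> /andP[]; lra.
Qed.

Lemma dot_double_unit_average J : in_tree J ->
  dot (@haar R double_unit) (average J) = r^-1.
Proof.
case: J => -[j|j] [l|l] //= /andP[_ hl].
have l0 := @dyadic_len_gt0 R (dyadic_nat j l).
transitivity (\int[mu]_x ((r^-1 / dyadic_len (dyadic_nat j l)) *
    \1_(dyadic_itv (dyadic_nat j l)) x))%R.
  apply: eq_Rintegral => x _; rewrite /average !indicE.
  have [/set_mem xJ|_] := boolP (x \in _); last by rewrite !(mul0r, mulr0).
  rewrite haar_double_unit; first by rewrite mulr1 mul1r.
  move: xJ; rewrite /dyadic_itv /= in_itv /= => /andP[x1 x2]; apply/andP; split.
    by apply: le_trans x1; rewrite mulr_ge0 ?(ltW l0).
  apply: lt_le_trans x2 _; rewrite -[(l + 1)%:~R]/((l + 1)%N%:R) dyadic_len_nat.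
  by rewrite ler_pdivrMr ?exprn_gt0 // mul1r -natrX ler_nat addn1.
rewrite RintegralZl //; last exact: integrable_indic_dyadic.
by rewrite Rintegral_indic_dyadic divfK ?gt_eqF.
Qed.

Variable k : nat.
Let s := tree_range (2 ^ k) (2 ^ k.+1).
(** The intervals in s make up 2^k generations, so their lengths add up to 2^k;
    the factor [r^-1 ^+ k] = 2^(-k/2) makes the profile a unit vector. *)
Definition weight I : R := r^-1 ^+ k * Num.sqrt (dyadic_len I).
Definition profile (x : measurableTypeR R) : R :=
  \sum_(I <- s) weight I * haar I x.

Lemma Lfun2_profile : profile \in Lfun mu 2%:E.
Proof. by apply: Lfun2_sum => I; apply: Lfun2Z; exact: Lfun2_haar. Qed.

Lemma dot_profile_haar J :
  dot profile (haar J) = if J \in s then weight J else 0.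
Proof.
rewrite dot_sum; [|exact: Lfun2_haar..].
under eq_bigr do rewrite dot_haar.
case: ifPn => Js.
  rewrite (bigD1_seq J) ?uniq_tree_range //= eqxx mulr1 big1 ?addr0 //.
  by move=> I /negPf ->; rewrite mulr0.
rewrite big1_seq // => I /= Is; case: eqP => [IJ|_]; last by rewrite mulr0.
by rewrite -IJ Is in Js.
Qed.

Lemma sum_tree_range (F : dyadic -> R) m n : \sum_(I <- tree_range m n) F I =
  \sum_(m <= i < n) \sum_(0 <= l < 2 ^ i) F (dyadic_nat i l).
Proof. by rewrite big_allpairs_dep. Qed.

Lemma sqr_weight I : weight I ^+ 2 = 2 ^- k * dyadic_len I.
Proof.
rewrite exprMn sqr_sqrtr ?ltW ?dyadic_len_gt0 // exprAC exprVn sqr_sqrt2.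
by rewrite exprVn.
Qed.

Lemma sum_dyadic_len i :
  \sum_(0 <= l < 2 ^ i) dyadic_len (dyadic_nat i l) = 1 :> R.
Proof.
under eq_bigr do rewrite dyadic_len_nat.
rewrite sumr_const_nat subn0 -[LHS]mulr_natr natrX.
by rewrite mulVf // expf_neq0 ?pnatr_eq0.
Qed.

Lemma dot_profile : dot profile profile = 1.
Proof.
rewrite {1}/profile dot_sum; [|exact: Lfun2_haar|exact: Lfun2_profile].
transitivity (\sum_(I <- s) 2 ^- k * dyadic_len I : R).
  apply: eq_big_seq => I Is.
  by rewrite dotC dot_profile_haar Is -expr2 sqr_weight.
rewrite -mulr_sumr sum_tree_range; under eq_bigr do rewrite sum_dyadic_len.
by rewrite sumr_const_nat expnS mul2n -addnn addnK natrX mulVf //.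
Qed.

Lemma dot_haar_double_unit :
  dot (haar double_unit) (haar double_unit) = 1 :> R.
Proof. by rewrite dot_haar eqxx. Qed.

Lemma classA_profile : classA (tensor profile (haar double_unit)).
Proof.
have [Lf N1] := tensor_unit Lfun2_profile (Lfun2_haar R double_unit)
  dot_profile dot_haar_double_unit.
split=> //.
pose C a b : R := if (b == double_unit) && (a \in s) then weight a else 0.
exists C.
  have -> : tensor profile (haar double_unit) = (fun z =>
    \sum_(p <- [seq (a, double_unit) | a <- s])
      C p.1 p.2 * tensor (haar p.1) (haar p.2) z).
    apply/funext => -[x y]; rewrite big_map /tensor /= /profile mulr_suml.
    by apply: eq_big_seq => I Is; rewrite /C eqxx Is /= mulrA.
  apply: finite_haar_expansion => [|a b].
    by rewrite map_inj_uniq ?uniq_tree_range // => a b [].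
  apply: contraNeq; rewrite /C.
  case: ifP => [/andP[/eqP -> sa] _|]; last by rewrite eqxx.
  exact: map_f.
apply: (@sub_finite_set _ _ [set` s]) => [I [J]|]; last exact: finite_seq.
by rewrite /C /=; case: ifP => [/andP[]|]; rewrite ?eqxx.
Qed.

Lemma classB_profile : classB (tensor (haar double_unit) profile).
Proof.
have [Lf N1] := tensor_unit (Lfun2_haar R double_unit) Lfun2_profile
  dot_haar_double_unit dot_profile.
split=> //.
pose C a b : R := if (a == double_unit) && (b \in s) then weight b else 0.
exists C.
  have -> : tensor (haar double_unit) profile = (fun z =>
    \sum_(p <- [seq (double_unit, b) | b <- s])
      C p.1 p.2 * tensor (haar p.1) (haar p.2) z).
    apply/funext => -[x y]; rewrite big_map /tensor /= /profile mulr_sumr.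
    by apply: eq_big_seq => I Is; rewrite /C eqxx Is /= mulrCA.
  apply: finite_haar_expansion => [|a b].
    by rewrite map_inj_uniq ?uniq_tree_range // => a b [].
  apply: contraNeq; rewrite /C.
  case: ifP => [/andP[/eqP -> sa] _|]; last by rewrite eqxx.
  exact: map_f.
apply: (@sub_finite_set _ _ [set` s]) => [J [I]|]; last exact: finite_seq.
by rewrite /C /=; case: ifP => [/andP[]|]; rewrite ?eqxx.
Qed.

(** Each pair of generations of the block contributes 2^(-k/2) 2^(-k) / 2, the
    lengths of the intervals of each generation adding up to 1, and there are
    4^k such pairs. *)
Lemma P_form_profile :
  P_form (fun I J => `|hadamard_lam R I J|)
    (tensor profile (haar double_unit)) (tensor (haar double_unit) profile) =
  r ^+ k / 2.
Proof.
rewrite /P_form; set F := (X in \sum_(p \in _) X p).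
have FE I J : F (I, J) = `|hadamard_lam R I J| *
    (dot profile (haar I) * dot (haar double_unit) (average J)) *
    (dot (haar double_unit) (average I) * dot profile (haar J)).
  by rewrite /F /= !inner_tensor //;
    [exact: Lfun2_haar|exact: Lfun2_profile|exact: Lfun2_average
    |exact: Lfun2_haar|exact: Lfun2_profile|exact: Lfun2_haar
    |exact: Lfun2_haar|exact: Lfun2_average].
rewrite (@fsum_tree _ F (2 ^ k) (2 ^ k.+1)) => [|[I J]]; last first.
  rewrite FE !dot_profile_haar /=; apply: contra_neqT.
  rewrite negb_and => /orP[] /negPf ->.
    by rewrite mul0r mulr0 mul0r.
  by rewrite !mulr0.
have r2 : r ^+ 2 = 2 := sqr_sqrt2 R.
have r0 : 0 < r by rewrite sqrtr_gt0.
have rk0 : r ^+ k != 0 by rewrite expf_neq0 ?gt_eqF.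
pose c : R := r^-1 ^+ k * 2 ^- k / 2.
transitivity (\sum_(2 ^ k <= i < 2 ^ k.+1) \sum_(2 ^ k <= j < 2 ^ k.+1)
    \sum_(0 <= a < 2 ^ i) \sum_(0 <= b < 2 ^ j)
      c * (dyadic_len (dyadic_nat i a) * dyadic_len (dyadic_nat j b))).
  apply: eq_big_nat => i hi; apply: eq_big_nat => j hj.
  apply: eq_big_nat => a /andP[_ ai]; apply: eq_big_nat => b /andP[_ bj].
  have i0 : (0 < i)%N by apply: leq_trans (proj1 (andP hi)); rewrite expn_gt0.
  have j0 : (0 < j)%N by apply: leq_trans (proj1 (andP hj)); rewrite expn_gt0.
  have ti : in_tree (dyadic_nat i a) by rewrite /= i0.
  have tj : in_tree (dyadic_nat j b) by rewrite /= j0.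
  rewrite FE !dot_profile_haar !mem_tree_range hi hj ai bj.
  rewrite !dot_double_unit_average //.
  rewrite /hadamard_lam ti tj !normrM !(ger0_norm (sqrtr_ge0 _)).
  rewrite (norm_scale_matrix R hi hj) /weight -/r /c.
  rewrite -[in RHS](sqr_sqrtr (ltW (@dyadic_len_gt0 R (dyadic_nat i a)))).
  rewrite -[in RHS](sqr_sqrtr (ltW (@dyadic_len_gt0 R (dyadic_nat j b)))).
  rewrite -r2 -exprM mulnC exprM exprVn /=.
  by field; rewrite rk0 gt_eqF.
transitivity (\sum_(2 ^ k <= i < 2 ^ k.+1) \sum_(2 ^ k <= j < 2 ^ k.+1) c).
  apply: eq_bigr => i _; apply: eq_bigr => j _.
  under eq_bigr do under eq_bigr do rewrite mulrA.
  under eq_bigr do rewrite -mulr_sumr sum_dyadic_len mulr1.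
  by rewrite -mulr_sumr sum_dyadic_len mulr1.
have -> : \sum_(2 ^ k <= i < 2 ^ k.+1) \sum_(2 ^ k <= j < 2 ^ k.+1) c =
    c * (2 ^+ k * 2 ^+ k).
  rewrite !sumr_const_nat expnS mul2n -addnn addnK -mulrnA -[LHS]mulr_natr.
  by rewrite natrM natrX.
have -> : 2 ^+ k = (r ^+ k) ^+ 2 :> R by rewrite -exprM mulnC exprM r2.
have e : (2 : R) ^- k = (r ^+ k) ^- 2 by rewrite -exprM mulnC exprM r2.
by rewrite /c e exprVn; field.
Qed.

End Lower.

(** Only even k are used, so that the lower bound r ^+ k / 2 is half a power
    of 2. *)
Lemma P_norm_abs_hadamard_lam (R : realType) :
  P_norm (fun I J => `|hadamard_lam R I J|) = +oo%E.
Proof.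
apply/eqyP => A A0; have [m Am] : exists m : nat, A < m%:R.
  by exists (Num.bound A); exact: archi_boundP (ltW A0).
apply: (@le_trans _ _ (`|(Num.sqrt 2 : R) ^+ (2 * m.+1) / 2|)%:E).
  rewrite lee_fin exprM sqr_sqrt2 exprS mulrC mulKf ?pnatr_eq0 //.
  rewrite ger0_norm ?exprn_ge0 // (le_trans (ltW Am)) // -natrX ler_nat.
  exact: ltnW (ltn_expl m (isT : 1 < 2)%N).
rewrite -(P_form_profile R (2 * m.+1)); apply: ereal_sup_ubound.
exists (tensor (profile (2 * m.+1)) (haar double_unit)).
  exact: classA_profile.
exists (tensor (haar double_unit) (profile (2 * m.+1))) => //.
exact: classB_profile.
Qed.

Theorem corollary1p3 (R : realType) :
  exists lam : dyadic -> dyadic -> R,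
    [/\ (P_norm lam < +oo)%E,
        P_norm (fun I J => `|lam I J|) = +oo%E &
        P_bounded lam /\ ~ P_unconditionally_bounded lam].
Proof.
have bounded : (P_norm (hadamard_lam R) < +oo)%E.
  by rewrite (le_lt_trans (P_norm_hadamard_lam_le1 R)) ?ltry.
exists (hadamard_lam R); split=> //; first exact: P_norm_abs_hadamard_lam.
split=> //; rewrite /P_unconditionally_bounded => /lt_geF/negP; apply.
rewrite -(P_norm_abs_hadamard_lam R); apply: ereal_sup_ubound.
(* The signs of the coefficients themselves. *)
exists (fun I J => if 0 <= hadamard_lam R I J then 1 else -1).
  by move=> I J /=; case: ifP; [left|right].
congr P_norm; apply/funext => I; apply/funext => J.
by case: ger0P => _; rewrite ?mul1r ?mulN1r.
Qed.
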